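(* Let $\mathcal E=(E_n)_{n\in\omega}$ be a continuous signature and let $\mathcal K$ be a quasivariety of topological $\mathcal E$-algebras. Let $X$ be a subspace of a topological space $Y$, let $e:X\to Y$ be the inclusion map, and let $(F(X),i_X)$, $(F(Y),i_Y)$ be the free universal algebras of $X$ and $Y$ in $\mathcal K$. Suppose that $X$ is an $HM$-valued retract of $Y$ and that $HM(F(X))\in\mathcal K$. Then the induced homomorphism $F(e):F(X)\to F(Y)$, i.e. the unique continuous homomorphism with $F(e)\circ i_X=i_Y\circ e$, is a topological embedding. If, in addition, $\mathcal K$ consists of Hausdorff topological $\mathcal E$-algebras, then $F(e)$ is a closed topological embedding.
   Context: A continuous signature is a sequence $\mathcal E=(E_n)_{n\in\omega}$ of topological spaces. A topological $\mathcal E$-algebra is a topological space $X$ endowed with a sequence of continuous maps $e_n:E_n\times X^n\to X$, $n\in\omega$ (the algebraic operations of $X$). A subset $A\subset X$ is a subalgebra if $e_n(E_n\times A^n)\subset A$ for all $n\in\omega$ (it carries the subspace topology and the restricted operations). Cartesian products of topological $\mathcal E$-algebras carry the product topology and coordinatewise operations. A homomorphism between topological $\mathcal E$-algebras $(X,(e_n^X))$ and $(Y,(e_n^Y))$ is a map $h:X\to Y$ (not assumed continuous) such that $e_n^Y(c,h(x_1),\dots,h(x_n))=h(e_n^X(c,x_1,\dots,x_n))$ for all $n\in\omega$, $c\in E_n$, $x_1,\dots,x_n\in X$. A class $\mathcal K$ of topological $\mathcal E$-algebras is a quasivariety if it is closed under taking subalgebras and arbitrary Cartesian products. A free universal algebra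 of a topological space $X$ in the class $\mathcal K$ is a pair $(F(X),i_X)$ consisting of a topological $\mathcal E$-algebra $F(X)\in\mathcal K$ and a continuous map $i_X:X\to F(X)$ such that for every continuous map $f:X\to K$ into a topological $\mathcal E$-algebra $K\in\mathcal K$ there is a unique continuous homomorphism $h:F(X)\to K$ with $f=h\circ i_X$. If $\mathcal K$ is a quasivariety, it is known that a free universal algebra of every topological space exists and is unique up to topological isomorphism (a bijective homomorphism that is a homeomorphism). Hartman-Mycielski construction: for a topological space $X$, $HM(X)$ is the set of all functions $f:[0,1)\to X$ for which there is a sequence $0=a_0<a_1<\dots<a_n=1$ such that $f$ is constant on each $[a_{i-1},a_i)$, $1\le i\le n$. A neighborhood sub-base of the topology of $HM(X)$ at $f\in HM(X)$ consists of the sets $N(a,b,V,\varepsilon)=\{g\in HM(X): |\{t\in[a,b): g(t)\notin V\}|<\varepsilon\}$, where $0\le a<b\le 1$, $f$ is constant on $[a,b)$, $V$ is a neighborhood of $f(a)$ in $X$, $\varepsilon>0$, and $|\cdot|$ is Lebesgue measure on $[0,1)$. The map $hm_X:X\to HM(X)$ sends $x$ to the constant function $t\mapsto x$; it is a topological embedding. If $(X,(e_n)_{n\in\omega})$ is a topological $\mathcal E$-algebra, then $HM(X)$ is regarded as a topological $\mathcal E$-algebra with the pointwise operations $e_n^{HM}(c,f_1,\dots,f_n)(t)=e_n(c,f_1(t),\dots,f_n(t))$ for $c\in E_n$, $f_1,\dots,f_n\in HM(X)$, $t\in[0,1)$. A subspace $X$ of a topological space $Y$ is an $HM$-valued retract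 of $Y$ if there is a continuous map $r:Y\to HM(X)$ with $r(x)=hm_X(x)$ for all $x\in X$. A closed topological embedding is a topological embedding with closed image. *)

(* Defs.v *)
From HB Require Import structures.
From mathcomp Require Import all_boot all_order all_algebra.
From mathcomp Require Import all_classical all_reals all_analysis.

Set Implicit Arguments.
Unset Strict Implicit.
Unset Printing Implicit Defensive.

Import Order.TTheory GRing.Theory Num.Theory.
Import numFieldNormedType.Exports.

Local Open Scope classical_set_scope.
Local Open Scope ring_scope.

Section Embeddings.
Context {S T : topologicalType}.

(* The last clause says that f is open onto its image, that is, that the
   inverse f(S) -> S is continuous for the subspace topology of f(S). *)
Definition topological_embedding (f : S -> T) : Prop :=
  [/\ injective f, continuous f &
      forall U : set S, open U ->
        exists2 V : set T, open V & f @` U = V `&` range f].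

Definition closed_topological_embedding (f : S -> T) : Prop :=
  topological_embedding f /\ closed (range f).

End Embeddings.

Section Continuity.

Lemma continuous_to_prod (S : topologicalType) (I : Type)
    (T : I -> topologicalType) (f : S -> prod_topology T) :
  (forall i, continuous (fun x => f x i)) -> continuous f.
Proof.
move=> fc x; apply/cvg_sup => i U [_ [[W oW <-] Wfx sWU]].
apply: (filterS (P := fun y => W (f y i))); first by move=> y /sWU.
by apply: (fc i x); apply: open_nbhs_nbhs; split.
Qed.

Lemma continuous_prod_proj (I : Type) (T : I -> topologicalType) (i : I) :
  continuous (fun f : prod_topology T => f i).
Proof.
move=> f U; rewrite nbhsE => -[W [oW Wf] sWU].
have /cvg_sup/(_ i) : f --> f by apply: cvg_id.
apply; exists ((fun g : prod_topology T => g i) @^-1` W); split => //.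
  by exists W.
by move=> g /sWU.
Qed.

Lemma continuous_to_set_type (S T : topologicalType) (A : set T)
    (f : S -> set_type A) :
  continuous (fun x => set_val (f x)) -> continuous f.
Proof.
move=> fc x U [_ [[W oW <-] Wfx sWU]].
apply: (filterS (P := fun y => W (set_val (f y)))); first by move=> y /sWU.
by apply: (fc x); apply: open_nbhs_nbhs; split.
Qed.

Lemma continuous_set_val (T : topologicalType) (A : set T) :
  continuous (set_val : set_type A -> T).
Proof. exact: initial_continuous. Qed.

Lemma nbhs_finprod (n : nat) (T : topologicalType)
    (x : prod_topology (fun _ : 'I_n => T)) (Q : set ('I_n -> T)) :
  nbhs x Q -> exists U : 'I_n -> set T,
    (forall i, nbhs (x i) (U i)) /\ [set y | forall i, U i (y i)] `<=` Q.
Proof.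
pose G : set_system ('I_n -> T) := [set Q | exists U : 'I_n -> set T,
    (forall i, nbhs (x i) (U i)) /\ [set y | forall i, U i (y i)] `<=` Q].
have GF : Filter G.
  split.
  - by exists (fun=> setT); split => // i; exact: filterT.
  - move=> A B [U [Ux UA]] [V [Vx VB]]; exists (fun i => U i `&` V i); split.
      by move=> i; apply: filterI.
    by move=> y /= yUV; split; [apply: UA | apply: VB] => i; case: (yUV i).
  - by move=> A B AB [U [Ux UA]]; exists U; split => // y /UA /AB.
suff : G --> x by move=> /(_ Q).
apply/cvg_sup => i U [_ [[W oW <-] Wx sWU]].
exists (fun j => if j == i then W else setT); split.
  move=> j; case: eqP => [->|_]; last exact: filterT.
  exact: open_nbhs_nbhs.
by move=> y /= /(_ i); rewrite eqxx => /sWU.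
Qed.

End Continuity.

Section TopologicalAlgebras.
Variable E : nat -> topologicalType.

Record topAlgebra := TopAlgebra {
  carrier :> topologicalType;
  alg_op : forall n, E n * prod_topology (fun _ : 'I_n => carrier) -> carrier;
  alg_op_continuous : forall n, continuous (@alg_op n)
}.

Lemma alg_op_comp_continuous (S : topologicalType) (A : topAlgebra) n
    (c : S -> E n) (x : S -> 'I_n -> A) :
  continuous c -> (forall i, continuous (fun s => x s i)) ->
  continuous (fun s => alg_op (c s, x s)).
Proof.
move=> cc cx s.
pose x' : S -> prod_topology (fun _ : 'I_n => carrier A) := x.
have cx' : continuous x' by apply: continuous_to_prod.
apply: (@continuous_comp _ _ _ (fun s => (c s, x' s)) (@alg_op A n)).
  exact: (cvg_pair (cc s) (cx' s)).
exact: alg_op_continuous.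
Qed.

Lemma arg_continuous (A : topologicalType) n (i : 'I_n) :
  continuous (fun p : E n * prod_topology (fun _ : 'I_n => A) => p.2 i).
Proof.
move=> p.
apply: (@continuous_comp _ _ _ snd
  (fun q : prod_topology (fun _ : 'I_n => A) => q i)); first exact: cvg_snd.
exact: continuous_prod_proj.
Qed.

Definition is_hom (A B : topAlgebra) (h : A -> B) : Prop :=
  forall (n : nat) (c : E n) (x : 'I_n -> A),
    alg_op (c, fun i => h (x i)) = h (alg_op (c, x)).

Definition is_subalgebra (A : topAlgebra) (S : set A) : Prop :=
  forall (n : nat) (c : E n) (x : 'I_n -> A),
    (forall i, S (x i)) -> S (alg_op (c, x)).

Section Subalgebra.
Variables (A : topAlgebra) (S : set A) (SA : is_subalgebra S).

Lemma sub_op_in n (p : E n * prod_topology (fun _ : 'I_n => set_type S)) :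
  alg_op (p.1, fun i => set_val (p.2 i)) \in S.
Proof. by apply/mem_set/SA => i; exact: set_valP. Qed.

Definition sub_op n (p : E n * prod_topology (fun _ : 'I_n => set_type S)) :
    set_type S :=
  exist (fun x => x \in S) _ (sub_op_in p).

Lemma sub_op_continuous n : continuous (@sub_op n).
Proof.
apply: continuous_to_set_type.
apply: alg_op_comp_continuous => [p|i p]; first exact: cvg_fst.
apply: continuous_comp; last exact: continuous_set_val.
exact: arg_continuous.
Qed.

Definition sub_algebra : topAlgebra := TopAlgebra sub_op_continuous.

End Subalgebra.

Section Product.
Variables (I : Type) (A : I -> topAlgebra).
Local Notation P := (prod_topology (fun i => A i : topologicalType)).

Definition prod_op n (p : E n * prod_topology (fun _ : 'I_n => P)) : P :=
  fun i => alg_op (p.1, fun k => p.2 k i).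

Lemma prod_op_continuous n : continuous (@prod_op n).
Proof.
apply: continuous_to_prod => i.
apply: alg_op_comp_continuous => [p|k p]; first exact: cvg_fst.
apply: (@continuous_comp _ _ _
  (fun p : E n * prod_topology (fun _ : 'I_n => P) => p.2 k) (fun q : P => q i)).
  exact: arg_continuous.
exact: continuous_prod_proj.
Qed.

Definition prod_algebra : topAlgebra := TopAlgebra prod_op_continuous.

End Product.

Definition quasivariety (K : topAlgebra -> Prop) : Prop :=
  (forall (A : topAlgebra) (S : set A) (SA : is_subalgebra S),
     K A -> K (sub_algebra SA)) /\
  (forall (I : Type) (A : I -> topAlgebra),
     (forall i, K (A i)) -> K (prod_algebra A)).

Definition is_free_algebra (K : topAlgebra -> Prop) (X : topologicalType)
    (F : topAlgebra) (i : X -> F) : Prop :=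
  [/\ K F, continuous i &
      forall (L : topAlgebra), K L -> forall f : X -> L, continuous f ->
        exists! h : F -> L, [/\ continuous h, is_hom h & f = h \o i]].

Lemma induced_hom_exists (K : topAlgebra -> Prop) (X Y : topologicalType)
    (FX FY : topAlgebra) (iX : X -> FX) (iY : Y -> FY) (e : X -> Y) :
  is_free_algebra K iX -> is_free_algebra K iY -> continuous e ->
  exists! h : FX -> FY, [/\ continuous h, is_hom h & iY \o e = h \o iX].
Proof.
move=> [_ _ univ] [KFY ciY _] ce; apply: univ => // x.
by apply: continuous_comp; [exact: ce | exact: ciY].
Qed.

End TopologicalAlgebras.

Section HartmanMycielski.
Variable R : realType.

Definition unit_interval : Type := set_type [set t : R | 0 <= t < 1].

Definition constant_on (X : Type) (f : unit_interval -> X) (a b : R) : Prop :=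
  forall t u : unit_interval,
    a <= set_val t < b -> a <= set_val u < b -> f t = f u.

Definition is_step (X : Type) (f : unit_interval -> X) : Prop :=
  exists (n : nat) (a : nat -> R),
    [/\ a 0%N = 0, a n = 1,
        forall i, (i < n)%N -> a i < a i.+1 &
        forall i, (i < n)%N -> constant_on f (a i) (a i.+1)].

Record HM (X : Type) := MkHM {
  HM_fun :> unit_interval -> X;
  HM_step : is_step HM_fun
}.

HB.instance Definition _ (X : Type) := gen_eqMixin (HM X).
HB.instance Definition _ (X : Type) := gen_choiceMixin (HM X).

(* As g is a step function, the measured set is a finite union of intervals,
   for any V. *)
Definition HM_N (X : Type) (a b : R) (V : set X) (eps : R) : set (HM X) :=
  [set g | (lebesgue_measure
     (set_val @` [set t : unit_interval | (a <= set_val t < b)%R /\ ~ V (g t)])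
     < eps%:E)%E].

Definition HM_subbase (X : topologicalType) (f : HM X) : set_system (HM X) :=
  [set N | exists (a : unit_interval) (b : R) (V : set X) (eps : R),
     [/\ set_val a < b <= 1, constant_on f (set_val a) b, nbhs (f a) V,
         0 < eps & N = HM_N (set_val a) b V eps]].

Definition HM_nbhs (X : topologicalType) (f : HM X) : set_system (HM X) :=
  smallest Filter (HM_subbase f).

(* t and u are not separated by any point of s; the half-open cells cut out by
   s on [0, 1) are the classes of this relation. *)
Let same_cell (s : seq R) (t u : R) := forall x, x \in s -> (x <= t) = (x <= u).

Lemma partition_cover n (a : nat -> R) (t : R) :
  a 0%N <= t -> t < a n -> exists2 j, (j < n)%N & a j <= t < a j.+1.
Proof.
elim: n => [|n IH] a0 tn; first by move: (le_lt_trans a0 tn); rewrite ltxx.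
have [an|an] := leP (a n) t; first by exists n => //; rewrite an.
by have [j jn aj] := IH a0 an; exists j => //; exact: ltnW.
Qed.

Lemma partition_exists (s : seq R) : exists (n : nat) (a : nat -> R),
  [/\ a 0%N = 0, a n = 1, forall i, (i < n)%N -> a i < a i.+1 &
      forall i, (i < n)%N -> forall t u,
        a i <= t < a i.+1 -> a i <= u < a i.+1 -> same_cell s t u].
Proof.
pose L := sort <=%R (undup [seq x <- s | 0 < x < 1]).
have Lin x : (x \in L) = (x \in s) && (0 < x < 1).
  by rewrite mem_sort mem_undup mem_filter andbC.
have Lp : path <%R 0 (rcons L 1).
  have Ls : sorted <%R L.
    by rewrite lt_sorted_uniq_le sort_uniq undup_uniq sort_sorted //; exact: le_total.
  rewrite rcons_path; apply/andP; split.
    rewrite path_min_sorted //; apply/allP => x.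
    by rewrite Lin => /andP[_ /andP[]].
  have : last 0 L \in 0 :: L by exact: mem_last.
  by rewrite inE => /orP[/eqP ->|]; [exact: ltr01 | rewrite Lin => /and3P[]].
pose a i := nth 1 (0 :: rcons L 1) i.
have amono i : (i < (size L).+1)%N -> a i < a i.+1.
  move=> iL; move/(pathP 1): Lp => /(_ i); rewrite size_rcons => /(_ iL).
  by [].
have amon i j : (i <= j)%N -> (j <= (size L).+1)%N -> a i <= a j.
  elim: j => [|j IH]; first by rewrite leqn0 => /eqP ->.
  rewrite leq_eqVlt => /orP[/eqP -> //|ij] jL.
  by apply: le_trans (ltW (amono _ jL)); apply: IH => //; exact: ltnW.
have a0 : a 0%N = 0 by [].
have an : a (size L).+1 = 1 by rewrite /a /= nth_rcons ltnn eqxx.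
exists (size L).+1, a; split => // i iL t u /andP[it ti] /andP[iu ui] x xs.
have i0 : 0 <= a i by rewrite -a0 amon // ltnW.
have i1 : a i.+1 <= 1 by rewrite -an amon.
have [x0|x0] := leP x 0.
  by rewrite !(le_trans x0) // (le_trans i0).
have [x1|x1] := leP 1 x.
  by rewrite !leNgt !(lt_le_trans _ x1) // (lt_le_trans _ i1).
have xL : x \in L by rewrite Lin xs x0 x1.
have jL : (index x L < size L)%N by rewrite index_mem.
have xa : x = a (index x L).+1.
  by rewrite /a /= nth_rcons jL nth_index.
have [ji|ij] := leqP (index x L).+1 i.
  have xi : x <= a i by rewrite xa amon // ltnW.
  by rewrite !(le_trans xi).
have ix : a i.+1 <= x by rewrite {}xa amon // ltnW.
by rewrite !leNgt !(lt_le_trans _ ix).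
Qed.

Lemma unit_intervalP (t : unit_interval) : 0 <= set_val t < 1.
Proof. exact: (set_valP t). Qed.

Lemma to_unit_interval (x : R) : 0 <= x < 1 ->
  exists t : unit_interval, set_val t = x.
Proof. by move=> x01; exists (exist _ x (mem_set (x01 : [set t : R | 0 <= t < 1] x))). Qed.

Lemma is_stepP (X : Type) (f : unit_interval -> X) :
  is_step f <-> exists s : seq R, forall t u : unit_interval,
    same_cell s (set_val t) (set_val u) -> f t = f u.
Proof.
split=> [[n [a [a0 an _ fa]]]|[s fs]]; last first.
  have [n [a [a0 an a_lt acell]]] := partition_exists s.
  exists n, a; split => // i iL t u ti ui; apply: fs; exact: (acell i).
exists [seq a i | i <- iota 0 n.+1] => t u tu.
have /andP[t0 t1] := unit_intervalP t.
have [||j jn tj] := @partition_cover n a (set_val t); rewrite ?a0 ?an //.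
apply: (fa j) => //.
have ain i : (i <= n)%N -> a i \in [seq a i | i <- iota 0 n.+1].
  by move=> iL; apply: map_f; rewrite mem_iota.
by rewrite ltNge -!tu ?ain -?ltNge //; exact: ltnW.
Qed.

Lemma cells_exist (s : seq R) : exists (m : nat) (q : nat -> R),
  [/\ forall t : unit_interval, exists2 j, (j < m)%N & q j <= set_val t < q j.+1,
      forall j, (j < m)%N -> exists t : unit_interval, set_val t = q j,
      forall j, (j < m)%N -> q j < q j.+1 <= 1 &
      forall j, (j < m)%N -> forall t u,
        q j <= t < q j.+1 -> q j <= u < q j.+1 -> same_cell s t u].
Proof.
have [m [q [q0 qm qlt qs]]] := partition_exists s.
have qmon i j : (i <= j)%N -> (j <= m)%N -> q i <= q j.
  elim: j => [|j IH]; first by rewrite leqn0 => /eqP ->.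
  rewrite leq_eqVlt => /orP[/eqP -> //|ij] jL.
  by apply: le_trans (ltW (qlt _ jL)); apply: IH => //; exact: ltnW.
exists m, q; split => //.
- move=> t; have /andP[t0 t1] := unit_intervalP t.
  by apply: partition_cover; rewrite ?q0 ?qm.
- move=> j jm; apply: to_unit_interval; rewrite -q0 qmon //= ?(ltnW jm) //.
  by rewrite (lt_le_trans (qlt _ jm)) // -qm qmon.
- by move=> j jm; rewrite qlt //= -qm qmon.
Qed.

Local Notation mu := (@lebesgue_measure R).

Lemma lebesgue_measure_outer : exists nu : OuterMeasure.type R R,
  mu = nu :> (set R -> \bar R).
Proof.
pose l := [the Content.type _ _ of (@wlength R idfun : set (ocitv_type R) -> _)].
by exists [the OuterMeasure.type R (ocitv_type R) of mu_ext l].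
Qed.

Lemma mu_mono (A B : set R) : A `<=` B -> (mu A <= mu B)%E.
Proof. by case: lebesgue_measure_outer => nu ->; exact: le_outer_measure. Qed.

Lemma mu_union (A B : set R) : (mu (A `|` B) <= mu A + mu B)%E.
Proof. by case: lebesgue_measure_outer => nu ->; exact: outer_measureU2. Qed.

Lemma mu_bigunion (m : nat) (A : set R) (B : nat -> set R) (eta : R) :
  (forall i, (i < m)%N -> (mu (B i) <= eta%:E)%E) ->
  (forall x, A x -> exists2 i, (i < m)%N & B i x) ->
  (mu A <= (m%:R * eta)%:E)%E.
Proof.
elim: m A => [|m IH] A mB AB.
  rewrite mul0r (_ : A = set0) ?measure0 //.
  by apply/seteqP; split => // x /AB [].
apply: (@le_trans _ _ (mu ([set x | exists2 i, (i < m)%N & B i x] `|` B m))).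
  apply: mu_mono => x /AB [i]; rewrite ltnS leq_eqVlt => /orP[/eqP ->|im] Bx.
    by right.
  by left; exists i.
apply: (le_trans (mu_union _ _)).
rewrite -natr1 mulrDl mul1r EFinD leeD ?mB //.
by apply: IH => // i im; apply: mB; exact: ltnW.
Qed.

Section Topology.
Variable X : topologicalType.
Implicit Types f g h : HM X.

Lemma HM_nbhs_singleton f (A : set (HM X)) : HM_nbhs f A -> A f.
Proof.
move: A; apply: (@smallest_sub _ Filter (HM_subbase f) [set A | A f]).
  by split => //= P Q PQ /PQ.
move=> _ [a [b [V [eps [ab fc fV e0 ->]]]]]; rewrite /HM_N /=.
rewrite (_ : _ @` _ = set0) ?measure0 ?lte_fin //.
apply/seteqP; split => // _ [t [tab nV] <-]; case: nV.
rewrite (fc t a) //; first exact: nbhs_singleton.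
by case/andP: ab => ab _; rewrite lexx.
Qed.

Lemma HM_nbhs_pfilter f : ProperFilter (HM_nbhs f).
Proof.
split; last exact: smallest_filter_filter.
by move=> /HM_nbhs_singleton.
Qed.

Lemma HM_N_mono (a b eps : R) (V W : set X) :
  W `<=` V -> HM_N a b W eps `<=` HM_N a b V eps.
Proof.
move=> WV g; apply: le_lt_trans; apply: mu_mono.
by move=> _ [t [tab nV] <-]; exists t => //; split => // /WV.
Qed.

Lemma slack (d eps : R) (m : nat) : d < eps ->
  exists2 eta : R, 0 < eta & d + m%:R * eta < eps.
Proof.
move=> de; exists ((eps - d) / m.+1%:R); first by rewrite divr_gt0 ?subr_gt0.
rewrite -ltrBrDl mulrCA gtr_pMr ?subr_gt0 // ltr_pdivrMr // mul1r ltr_nat.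
exact: ltnSn.
Qed.

Lemma HM_N_open (a b eps : R) (V : set X) g :
  open V -> HM_N a b V eps g -> HM_nbhs g (HM_N a b V eps).
Proof.
move=> oV gN.
have HF := HM_nbhs_pfilter g.
have [s gs] := (is_stepP _).1 (HM_step g).
have [m [q [qcov qpt qlt qs]]] := cells_exist (a :: b :: s).
pose D := set_val @` [set t : unit_interval | a <= set_val t < b /\ ~ V (g t)].
have {}gN : (mu D < eps%:E)%E by [].
have D0 : (0 <= mu D)%E by exact: measure_ge0.
have [d Dd] : exists d, mu D = d%:E.
  by move: gN D0; case: (mu D) => // r _ _; exists r.
have {D0}dlt : d < eps by rewrite -lte_fin -Dd.
have [eta eta0 etalt] := slack m dlt.
pose B h (j : nat) := set_val @` [set t : unit_interval |
  [/\ q j <= set_val t < q j.+1, a <= set_val t < b, V (g t) & ~ V (h t)]].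
have near_cells (j : 'I_m) : HM_nbhs g [set h | (mu (B h j) <= eta%:E)%E].
  have [u uq] := qpt _ (ltn_ord j).
  have uj : q j <= set_val u < q j.+1.
    by rewrite uq lexx; case/andP: (qlt _ (ltn_ord j)).
  have cst t : q j <= set_val t < q j.+1 -> same_cell (a :: b :: s) (set_val t) (set_val u).
    by move=> tj; exact: (qs j).
  have gcst : constant_on g (q j) (q j.+1).
    move=> t v tj vj; apply: gs => x xs; apply: (qs j) => //.
    by rewrite !inE xs !orbT.
  have [gu|ngu] := pselect (V (g u)); last first.
    apply: (filterS _ filterT) => h _ /=.
    rewrite (_ : B h j = set0) ?measure0 ?lee_fin ?ltW //.
    apply/seteqP; split => // _ [t [tj _ gt _] <-]; case: ngu.
    by rewrite (gcst u t).
  apply: (@filterS _ (HM_nbhs g) _ (HM_N (set_val u) (q j.+1) V eta)).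
    move=> h /ltW; apply: le_trans; apply: mu_mono => _ [t [tj _ _ nht] <-].
    by exists t => //; split => //; rewrite uq.
  apply: sub_gen_smallest; exists u, (q j.+1), V, eta; split => //.
  - by rewrite uq; exact: qlt.
  - by rewrite uq.
  - exact: open_nbhs_nbhs.
have near_all : HM_nbhs g [set h | forall j : 'I_m, (mu (B h j) <= eta%:E)%E].
  exact: (@filter_forall _ _ (fun j : 'I_m =>
    [set h | (mu (B h j) <= eta%:E)%E]) (HM_nbhs g) _ near_cells).
apply: (@filterS _ (HM_nbhs g) _ _ _ _ near_all) => h hB /=.
apply: (@le_lt_trans _ _ (mu (D `|` [set x | exists2 j, (j < m)%N & B h j x]))).
  apply: mu_mono => _ [t [tab nht] <-].
  have [gt|ngt] := pselect (V (g t)); last by left; exists t.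
  by right; have [j jm tj] := qcov t; exists j => //; exists t.
apply: (le_lt_trans (mu_union _ _)).
rewrite Dd; apply: (@le_lt_trans _ _ (d%:E + (m%:R * eta)%:E)%E).
  rewrite leeD2l // (@mu_bigunion m _ (B h)) //.
  by move=> i im; exact: (hB (Ordinal im)).
by rewrite -EFinD lte_fin.
Qed.

Lemma HM_nbhs_nbhs f (A : set (HM X)) :
  HM_nbhs f A -> HM_nbhs f [set g | HM_nbhs g A].
Proof.
have HF h : Filter (HM_nbhs h) by exact: smallest_filter_filter.
move: A; apply: (@smallest_sub _ Filter (HM_subbase f)
  [set A | HM_nbhs f [set g | HM_nbhs g A]]).
  split => /=.
  - apply: (@filterS _ (HM_nbhs f) _ setT); last exact: filterT.
    by move=> g _; exact: (@filterT _ (HM_nbhs g)).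
  - move=> P Q fP fQ; apply: (@filterS2 _ (HM_nbhs f) _ _ _ _ _ fP fQ) => g gP gQ.
    exact: (@filterI _ (HM_nbhs g)).
  - move=> P Q PQ fP; apply: (@filterS _ (HM_nbhs f) _ _ _ _ fP) => g gP.
    exact: (@filterS _ (HM_nbhs g) _ _ _ PQ gP).
move=> _ [a [b [V [eps [ab fc fV e0 ->]]]]] /=.
apply: (@filterS _ (HM_nbhs f) _ (HM_N (set_val a) b V° eps)).
  move=> g /HM_N_open => /(_ (open_interior V)) gN.
  apply: (@filterS _ (HM_nbhs g) _ _ _ _ gN).
  by apply: HM_N_mono; exact: interior_subset.
apply: sub_gen_smallest; exists a, b, V°, eps; split => //.
exact: nbhs_interior.
Qed.

HB.instance Definition _ := hasNbhs.Build (HM X) (@HM_nbhs X).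
HB.instance Definition _ := Nbhs_isNbhsTopological.Build (HM X)
  HM_nbhs_pfilter HM_nbhs_singleton HM_nbhs_nbhs.

End Topology.

Section Constant.

Lemma const_is_step (X : Type) (x : X) : is_step (fun=> x).
Proof.
by apply/is_stepP; exists [::].
Qed.

Definition hm (X : Type) (x : X) : HM X := MkHM (const_is_step x).

End Constant.

Definition HM_valued_retract (Y : topologicalType) (X : set Y) : Prop :=
  exists2 r : Y -> HM (set_type X), continuous r &
    forall x : set_type X, r (set_val x) = hm x.

Section PointwiseOperations.
Variables (E : nat -> topologicalType) (A : topAlgebra E).

Lemma pointwise_is_step n (c : E n) (f : 'I_n -> HM A) :
  is_step (fun t => alg_op (c, fun i => f i t)).
Proof.
apply/is_stepP.
have /choice [s fs] : forall i, exists s : seq R, forall t u : unit_interval,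
    same_cell s (set_val t) (set_val u) -> f i t = f i u.
  by move=> i; apply/is_stepP; exact: HM_step.
exists (flatten [seq s i | i <- enum 'I_n]) => t u tu.
congr (alg_op (c, _)); apply/funext => i; apply: fs => x xs; apply: tu.
by apply/flatten_mapP; exists i; rewrite // mem_enum.
Qed.

Definition HM_op n (p : E n * prod_topology (fun _ : 'I_n => HM A)) : HM A :=
  MkHM (pointwise_is_step p.1 p.2).

Lemma HM_op_continuous n : continuous (@HM_op n).
Proof.
move=> p; rewrite /continuous_at.
have Fp : Filter (nbhs p) by exact: nbhs_filter.
pose F : set_system (HM A) := [set N | nbhs p (@HM_op n @^-1` N)].
suff FN : HM_nbhs (HM_op p) `<=` F by exact: FN.
apply: smallest_sub.
move=> _ [a [b [V [eps [ab fc fV e0 ->]]]]]; rewrite /F /=.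
have /choice [s fs] : forall i, exists s : seq R, forall t u : unit_interval,
    same_cell s (set_val t) (set_val u) -> p.2 i t = p.2 i u.
  by move=> i; apply/is_stepP; exact: HM_step.
have [m [q [qcov qpt qlt qs]]] :=
  cells_exist (set_val a :: b :: flatten [seq s i | i <- enum 'I_n]).
have [eta eta0 etalt] := slack m e0.
have [eta' eta'0 eta'lt] := slack n eta0.
pose B (p' : E n * prod_topology (fun _ : 'I_n => HM A)) (j : nat) :=
  set_val @` [set t : unit_interval |
    [/\ q j <= set_val t < q j.+1, set_val a <= set_val t < b &
        ~ V (HM_op p' t)]].
have near_cells (j : 'I_m) : nbhs p [set p' | (mu (B p' j) <= eta%:E)%E].
  have [u uq] := qpt _ (ltn_ord j).
  have uj : q j <= set_val u < q j.+1.
    by rewrite uq lexx; case/andP: (qlt _ (ltn_ord j)).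
  have [uab|nuab] := boolP (set_val a <= set_val u < b); last first.
    apply: (@filterS _ (nbhs p) _ setT _ _ filterT) => p' _ /=.
    rewrite (_ : B p' j = set0) ?measure0 ?lee_fin ?ltW //.
    apply/seteqP; split => // _ [t [tj tab _] <-]; case/negP: nuab.
    have tu := qs _ (ltn_ord j) _ _ tj uj.
    by move: tab; rewrite !ltNge !tu // ?inE ?eqxx ?orbT.
  have : nbhs (HM_op p u) V.
    rewrite (fc u a) // lexx; by case/andP: ab.
  move=> /(@alg_op_continuous _ A n (p.1, fun i => p.2 i u)).
  case=> -[P Q] /= [Pp Qp] PQV.
  have [U [Up UQ]] := nbhs_finprod Qp.
  have nearU (i : 'I_n) : nbhs p [set p' : E n * prod_topology (fun _ : 'I_n => HM A) |
      HM_N (set_val u) (q j.+1) (U i) eta' (p'.2 i)].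
    apply: (@arg_continuous E (HM A) n i p); apply: sub_gen_smallest.
    exists u, (q j.+1), (U i), eta'; split => //.
    - by rewrite uq; exact: qlt.
    - move=> t v; rewrite uq => tj vj; apply: fs => x xs.
      apply: (qs j) => //; rewrite !inE; apply/orP; right; apply/orP; right.
      by apply/flatten_mapP; exists i; rewrite // mem_enum.
  have nearP : nbhs p [set p' : E n * prod_topology (fun _ : 'I_n => HM A) | P p'.1].
    exact: cvg_fst.
  near=> p' => /=.
  have p'P : P p'.1 by near: p'.
  have p'U : forall i, HM_N (set_val u) (q j.+1) (U i) eta' (p'.2 i).
    by near: p'; exact: filter_forall.
  pose C (k : nat) := [set x | exists2 i : 'I_n, val i = k &
    (set_val @` [set t : unit_interval |
       set_val u <= set_val t < q j.+1 /\ ~ U i (p'.2 i t)]) x].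
  apply: (@le_trans _ _ (n%:R * eta')%:E).
    apply: (@mu_bigunion n _ C).
      move=> k kn; apply: (le_trans _ (ltW (p'U (Ordinal kn)))).
      apply: mu_mono => x [i ik]; suff -> : i = Ordinal kn by [].
      exact: val_inj.
    move=> _ [t [tj tab nVt] <-].
    have [i nUi] : exists i, ~ U i (p'.2 i t).
      apply/existsNP => Ut; apply: nVt; apply: (PQV (p'.1, fun i => p'.2 i t)).
      by split => //=; exact: UQ.
    by exists i => //; exists i => //; exists t => //; split => //; rewrite uq.
  by rewrite lee_fin; move: eta'lt; rewrite add0r => /ltW.
have near_all : nbhs p [set p' | forall j : 'I_m, (mu (B p' j) <= eta%:E)%E].
  exact: (@filter_forall _ _ (fun j : 'I_m =>
    [set p' | (mu (B p' j) <= eta%:E)%E]) (nbhs p) _ near_cells).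
apply: (@filterS _ (nbhs p) _ _ _ _ near_all) => p' pB /=.
apply: (@le_lt_trans _ _ (m%:R * eta)%:E).
  apply: (@mu_bigunion m _ (B p')).
    by move=> i im; exact: (pB (Ordinal im)).
  by move=> _ [t [tab nVt] <-]; have [j jm tj] := qcov t; exists j => //; exists t.
by move: etalt; rewrite add0r lte_fin.
Unshelve. all: by end_near.
Qed.

Definition HM_algebra : topAlgebra E := TopAlgebra HM_op_continuous.

End PointwiseOperations.

End HartmanMycielski.

(* Main.v *)
Require Import Defs.
From mathcomp Require Import all_boot all_order all_algebra.
From mathcomp Require Import all_classical all_reals all_analysis.

(** The retraction [r : Y -> HM X], followed by [HM iX : HM X -> HM FX], is a
    continuous map from [Y] to an algebra of the class, so it extends to a
    continuous homomorphism [h : FY -> HM FX]. On the generators [iX] the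
    homomorphisms [h \o Fe] and [hm : FX -> HM FX] agree, because [r] restricts
    to [hm] on [X]; by freeness of [FX] they are equal. Thus [Fe] is the first
    factor of the embedding [hm] ([hm_embedding]), and the first factor of an
    embedding is an embedding ([factor_embedding]).

    If [FX] is Hausdorff, then the constant functions form a closed subset of
    [HM FX] ([closed_range_hm]), so [hm] is a closed embedding; the first
    factor of a closed embedding through a Hausdorff space is again closed
    ([factor_closed_embedding]). *)

Set Implicit Arguments.
Unset Strict Implicit.
Unset Printing Implicit Defensive.

Import Order.TTheory GRing.Theory Num.Theory.
Import numFieldNormedType.Exports.

Local Open Scope classical_set_scope.
Local Open Scope ring_scope.

(** * Factors of embeddings *)

Section Factor.
Variables (S T Z : topologicalType) (f : S -> T) (h : T -> Z).
Hypotheses (f_cont : continuous f) (h_cont : continuous h).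

Lemma embedding_preimage (g : S -> Z) (U : set S) :
  topological_embedding g -> open U -> exists2 W : set Z, open W & g @^-1` W = U.
Proof.
move=> [g_inj _ g_open] /g_open[W oW gU]; exists W => //.
apply/seteqP; split=> x Wx.
  have : (W `&` range g) (g x) by split => //; exists x.
  by rewrite -gU => -[y Uy /g_inj <-].
by have : (g @` U) (g x) by [exists x]; rewrite gU => -[].
Qed.

Lemma factor_embedding :
  topological_embedding (h \o f) -> topological_embedding f.
Proof.
move=> hf_emb; split => // [x y fxy|U oU].
  have [hf_inj _ _] := hf_emb.
  by apply: hf_inj; rewrite /= fxy.
have [W oW WU] := embedding_preimage hf_emb oU.
exists (h @^-1` W); first by apply: open_comp => // x _; exact: h_cont.
rewrite -WU; apply/seteqP; split=> [_ [x Wx <-]|y [Wy [x _ fxy]]].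
  by split => //; exists x.
by exists x => //; rewrite /= fxy.
Qed.

(** A point [y] adherent to the range of [f] is sent by [h] to some [h (f x)].
    Points [f z] close to [y] have [h (f z)] close to [h (f x)], hence [z]
    close to [x], hence [f z] close to [f x] as well; so [y = f x]. *)
Lemma factor_closed_embedding : hausdorff_space T ->
  closed_topological_embedding (h \o f) -> closed_topological_embedding f.
Proof.
move=> T_haus [hf_emb hf_closed]; split; first exact: factor_embedding.
move=> y cly.
have [x _ hfx] : range (h \o f) (h y).
  apply: hf_closed => B /h_cont hB.
  have [_ [[z _ <-] Bz]] := cly _ hB.
  by exists (h (f z)); split => //; exists z.
exists x => //; apply: T_haus => A B fxA yB.
have oU : open (f @^-1` A°).
  by apply: open_comp => [z _|]; [exact: f_cont|exact: open_interior].
have [W oW WU] := embedding_preimage hf_emb oU.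
have Wy : W (h y).
  have : (f @^-1` A°) x by exact: fxA.
  by rewrite -WU /preimage /= -hfx.
have yW : nbhs y (h @^-1` W) by apply: h_cont; exact: open_nbhs_nbhs.
have [_ [[z _ <-] [Wz Bz]]] := cly _ (filterI yW yB).
exists (f z); split => //; apply: interior_subset.
by have : ((h \o f) @^-1` W) z := Wz; rewrite WU.
Qed.

End Factor.

(** * Continuous maps between Hartman-Mycielski spaces *)

Section HartmanMycielski.
Variable R : realType.

Lemma HM_eq (X : Type) (f g : HM R X) : HM_fun f = HM_fun g -> f = g.
Proof.
case: f g => [f fs] [g gs] /= fg; case: _ / fg gs => gs.
by congr MkHM; exact: Prop_irrelevance.
Qed.

Lemma HM_nbhs_cvg (S X : topologicalType)
    (k : S -> HM R X) (s : S) :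
  (forall N, HM_subbase (k s) N -> nbhs s (k @^-1` N)) -> k x @[x --> s] --> k s.
Proof.
move=> kN.
suff ksN : HM_nbhs (k s) `<=` [set N | nbhs s (k @^-1` N)] by exact: ksN.
by apply: smallest_sub => //; exact: (fmap_filter k).
Qed.

Lemma open_HM_N (X : topologicalType) (a b eps : R) (V : set X) :
  open V -> open (HM_N a b V eps : set (HM R X)).
Proof. by move=> oV; rewrite openE => g; exact: HM_N_open. Qed.

Lemma comp_is_step (X Z : Type) (k : X -> Z) (f : HM R X) : is_step (k \o f).
Proof.
have [n [a [a0 an a_lt fa]]] := HM_step f.
by exists n, a; split => // i ni t u ti ui /=; rewrite (fa i ni t u).
Qed.

Definition HM_map (X Z : Type) (k : X -> Z) (f : HM R X) : HM R Z :=
  MkHM (comp_is_step k f).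

(** The function [k \o f] may be constant on an interval where [f] is not, so
    the preimage of a subbasic neighborhood need not be subbasic; it is
    however open by [open_HM_N], which has no constancy condition. *)
Lemma HM_map_continuous (X Z : topologicalType) (k : X -> Z) :
  continuous k -> continuous (HM_map k).
Proof.
move=> ck f; apply: HM_nbhs_cvg => _ [a [b [V [eps [ab kfc kfV e0 ->]]]]].
have oV : open (k @^-1` V°).
  by apply: open_comp => [z _|]; [exact: ck|exact: open_interior].
have kfN : HM_N (set_val a) b V° eps (HM_map k f).
  apply: HM_nbhs_singleton; apply: sub_gen_smallest.
  by exists a, b, V°, eps; split => //; exact: nbhs_interior.
have fN : nbhs f (HM_N (set_val a) b (k @^-1` V°) eps).
  by apply: open_nbhs_nbhs; split => //; exact: open_HM_N.
apply: (filterS (P := HM_N (set_val a) b (k @^-1` V°) eps)) fN => g gN.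
exact: (HM_N_mono (@interior_subset _ V)).
Qed.

(** * Constant functions in a Hartman-Mycielski space *)

Lemma HM_N_hm (X : Type) (a b eps : R) (V : set X) (x : X) :
  0 < eps -> V x -> HM_N a b V eps (hm R x).
Proof.
move=> e0 Vx; rewrite /HM_N /= (_ : _ @` _ = set0) ?measure0 ?lte_fin //.
by apply/seteqP; split => // y [t [_ /(_ Vx)]].
Qed.

(** The exceptional set of a constant function is empty or the whole
    interval from [a] to [b], of measure [b - a]. *)
Lemma hm_HM_N (X : Type) (a b : R) (V : set X) (x : X) :
  0 <= a -> a < b <= 1 -> HM_N a b V (b - a) (hm R x) -> V x.
Proof.
move=> a0 /andP[ab b1]; apply: contraPP => Vx; apply/negP; rewrite -leNgt.
have -> : set_val @` [set t : unit_interval R |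
    a <= set_val t < b /\ ~ V (hm R x t)] = `[a, b[%classic.
  apply/seteqP; split=> [_ [t [tab _] <-]|t]; rewrite /= in_itv //= => tab.
  have [u ut] : exists u : unit_interval R, set_val u = t.
    apply: to_unit_interval; case/andP: tab => at_ tb.
    by rewrite (le_trans a0) // (lt_le_trans tb).
  by exists u => //; rewrite ut.
by rewrite lebesgue_measure_itv /= lte_fin ab EFinB.
Qed.

Lemma hm_continuous (X : topologicalType) : continuous (@hm R X).
Proof.
move=> x; apply: HM_nbhs_cvg => _ [a [b [V [eps [_ _ xV e0 ->]]]]].
by apply: filterS xV => y Vy; exact: HM_N_hm.
Qed.

Lemma hm_embedding (X : topologicalType) : topological_embedding (@hm R X).
Proof.
have [u0 _] : exists u : unit_interval R, set_val u = 0.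
  by apply: to_unit_interval; rewrite lexx ltr01.
split=> [x y xy||U oU].
- exact: (congr1 (fun f : HM R X => f u0) xy).
- exact: hm_continuous.
exists (HM_N 0 1 U 1); first exact: open_HM_N.
apply/seteqP; split=> [_ [x Ux <-]|f [Ux [x _ xf]]].
  by split; [exact: HM_N_hm|exists x].
exists x => //; apply: (@hm_HM_N _ 0 1); rewrite ?ltr01 ?lexx //.
by rewrite xf subr0.
Qed.

Lemma HM_constant_right (X : Type) (f : HM R X) (t : unit_interval R) :
  exists2 b, set_val t < b <= 1 & constant_on f (set_val t) b.
Proof.
have [s fs] := (is_stepP _).1 (HM_step f).
have [m [q [qcov _ qlt qs]]] := cells_exist s.
have [j jm /andP[qt tq]] := qcov t.
exists (q j.+1); first by rewrite tq; case/andP: (qlt j jm).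
move=> u v /andP[tu uq] /andP[tv vq]; apply: fs; apply: (qs j jm).
  by rewrite (le_trans qt).
by rewrite (le_trans qt).
Qed.

(** If [f] takes two values [f t] and [f u] with disjoint neighborhoods [V] and
    [W], then a function close to [f] has values in [V] just after [t] and
    values in [W] just after [u], so it is not constant. *)
Lemma closed_range_hm (X : topologicalType) :
  hausdorff_space X -> closed (range (@hm R X)).
Proof.
move=> X_haus f clf.
have fc (t u : unit_interval R) : f t = f u.
  apply: X_haus => V W tV uW.
  have subbasic v (A : set X) : nbhs (f v) A ->
      exists2 b, set_val v < b <= 1 & nbhs f (HM_N (set_val v) b A (b - set_val v)).
    move=> vA; have [b vb fvb] := HM_constant_right f v.
    exists b => //; apply: sub_gen_smallest.
    exists v, b, A, (b - set_val v); split => //.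
    by rewrite subr_gt0; case/andP: vb.
  have [b tb fV] := subbasic t V tV.
  have [c uc fW] := subbasic u W uW.
  have [_ [[x _ <-] [xV xW]]] := clf _ (filterI fV fW).
  have [/andP[t0 _] /andP[u0 _]] := (unit_intervalP t, unit_intervalP u).
  by exists x; split; [exact: hm_HM_N xV|exact: hm_HM_N xW].
have [u0 _] : exists u : unit_interval R, set_val u = 0.
  by apply: to_unit_interval; rewrite lexx ltr01.
by exists (f u0) => //; apply: HM_eq; apply/funext => t; exact: fc.
Qed.

End HartmanMycielski.

(** * The induced homomorphism of free algebras *)

Lemma is_hom_comp (E : nat -> topologicalType) (A B C : topAlgebra E)
    (g : B -> C) (f : A -> B) : is_hom g -> is_hom f -> is_hom (g \o f).
Proof. by move=> gh fh n c x; rewrite /= -fh -gh. Qed.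

Lemma hm_is_hom (R : realType) (E : nat -> topologicalType) (A : topAlgebra E) :
  is_hom (@hm R A : A -> HM_algebra R A).
Proof. by move=> n c x; exact: HM_eq. Qed.

Lemma free_algebra_hom_unique (E : nat -> topologicalType)
    (K : topAlgebra E -> Prop) (X : topologicalType) (F L : topAlgebra E)
    (i : X -> F) (g h : F -> L) :
  is_free_algebra K i -> K L -> continuous g -> is_hom g ->
  continuous h -> is_hom h -> g \o i = h \o i -> g = h.
Proof.
move=> [_ ci univ] KL cg gh ch hh gih.
have cgi : continuous (g \o i).
  by move=> x; apply: continuous_comp; [exact: ci|exact: cg].
have [k [_ kuniq]] := univ L KL _ cgi.
by rewrite -(kuniq g) // -(kuniq h).
Qed.

(** The composite of [Fe] with the extension of [HM iX \o r] to [FY] is [hm],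
    since both agree on the generators of [FX]. *)
Lemma induced_hom_factors_hm (R : realType) (E : nat -> topologicalType)
    (K : topAlgebra E -> Prop) (Y : topologicalType) (X : set Y)
    (FX FY : topAlgebra E) (iX : set_type X -> FX) (iY : Y -> FY)
    (Fe : FX -> FY) :
  is_free_algebra K iX -> is_free_algebra K iY -> HM_valued_retract R X ->
  K (HM_algebra R FX) -> continuous Fe -> is_hom Fe ->
  Fe \o iX = iY \o set_val ->
  exists2 h : FY -> HM R FX, continuous h & h \o Fe = @hm R FX.
Proof.
move=> FX_free [_ _ FY_univ] [r cr rX] KHM cFe Fe_hom Fe_unit.
have [_ ciX _] := FX_free.
have cf : continuous (HM_map iX \o r : Y -> HM_algebra R FX).
  by move=> y; apply: continuous_comp; [exact: cr|exact: HM_map_continuous].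
have [h [[ch h_hom hiY] _]] := FY_univ _ KHM _ cf.
exists h => //; apply: (free_algebra_hom_unique FX_free KHM).
- by move=> x; apply: continuous_comp; [exact: cFe|exact: ch].
- exact: is_hom_comp.
- exact: hm_continuous.
- exact: hm_is_hom.
- apply/funext => x /=.
  have -> : Fe (iX x) = iY (set_val x) by exact: (congr1 (@^~ x) Fe_unit).
  rewrite -[h _]/((h \o iY) _) -hiY /= rX.
  exact: HM_eq.
Qed.

Theorem theorem2 (R : realType) (E : nat -> topologicalType)
    (K : topAlgebra E -> Prop) (K_quasivariety : quasivariety K)
    (Y : topologicalType) (X : set Y)
    (FX FY : topAlgebra E) (iX : set_type X -> FX) (iY : Y -> FY)
    (FX_free : is_free_algebra K iX) (FY_free : is_free_algebra K iY)
    (X_retract : HM_valued_retract R X)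
    (HM_FX_in_K : K (HM_algebra R FX))
    (Fe : FX -> FY) (Fe_continuous : continuous Fe) (Fe_hom : is_hom Fe)
    (Fe_unit : Fe \o iX = iY \o set_val) :
  topological_embedding Fe /\
  ((forall L : topAlgebra E, K L -> hausdorff_space L) ->
   closed_topological_embedding Fe).
Proof.
have [h ch hFe] := induced_hom_factors_hm FX_free FY_free X_retract HM_FX_in_K
  Fe_continuous Fe_hom Fe_unit.
split=> [|K_haus].
  by apply: (factor_embedding Fe_continuous ch); rewrite hFe; exact: hm_embedding.
have [[KFX _ _] [KFY _ _]] := (FX_free, FY_free).
apply: (factor_closed_embedding Fe_continuous ch (K_haus _ KFY)).
rewrite hFe; split; first exact: hm_embedding.
exact: closed_range_hm (K_haus _ KFX).
Qed.
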